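(* Let $p\ge1$, $m=2p$, let $\{\beta(k)\}_{k\ge0}$ be $p\times m$ matrices with $\beta(k)J\beta(k)^*=I_p$, put $C_k=2K^*\beta(k)^*\beta(k)K-j$, and consider the system $W_{k+1}(\lambda)-W_k(\lambda)=-\frac{i}{\lambda}jC_kW_k(\lambda)$, $W_0=I_m$, on the semiaxis $k\ge0$. Let $\varphi_\infty$ be the unique element of $\bigcap_{N\ge0}\mathcal N(N)$. Then $\lambda\mapsto\varphi_\infty(\bar\lambda)^*$ is the unique $p\times p$ matrix function $\varphi$ holomorphic in the open upper half-plane $\mathbb C_+$ such that for every $\lambda\in\mathbb C_+$ $$\sum_{k=0}^\infty[i\varphi(\lambda)^*\ \ I_p]\,q(\lambda)^kKW_k(\lambda)^*C_kW_k(\lambda)K^*\begin{bmatrix}-i\varphi(\lambda)\\ I_p\end{bmatrix}<\infty,$$ i.e. it is the unique Weyl function in $\mathbb C_+$ of the system on the semiaxis.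
   Context: $\mathbb C_-$ is the open lower half-plane; $q(\lambda)=|\lambda|^2(|\lambda|^2+1)^{-1}$; $j=\mathrm{diag}(I_p,-I_p)$, $J=\begin{bmatrix}0&I_p\\ I_p&0\end{bmatrix}$, $K=\frac1{\sqrt2}\begin{bmatrix}I_p&-I_p\\ I_p&I_p\end{bmatrix}$. For $N\ge0$ let $\mathcal W(N,\lambda)=\{\mathcal W_{ij}(N,\lambda)\}_{i,j=1}^2=KW_{N+1}(\bar\lambda)^*$ ($p\times p$ blocks), and $\mathcal N(N)$ the set of $p\times p$ matrix functions holomorphic in $\mathbb C_-$ of the form $i(\mathcal W_{21}(N,\cdot)R+\mathcal W_{22}(N,\cdot)Q)(\mathcal W_{11}(N,\cdot)R+\mathcal W_{12}(N,\cdot)Q)^{-1}$, with $R,Q$ $p\times p$ matrix functions meromorphic in $\mathbb C_-$, well defined at $-i$, $R^*R+Q^*Q>0$, $R^*R\le Q^*Q$. (It is known that $\bigcap_N\mathcal N(N)$ consists of exactly one function.) The series condition means convergence of the series of positive semidefinite matrices. *)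

(* Defs.v *)
From mathcomp Require Import all_boot all_order all_algebra.
From mathcomp Require Import reals.
From mathcomp.real_closed Require Export complex.
Import GRing.Theory Num.Theory.
Local Open Scope ring_scope.

Set Implicit Arguments.
Unset Strict Implicit.
Unset Printing Implicit Defensive.

Section Defs.
Variable R : realType.
Local Notation C := (R[i]).

Definition mxstar m n (A : 'M[C]_(m, n)) : 'M[C]_(n, m) :=
  (map_mx Num.conj A)^T.

Definition lowerHP (z : C) : Prop := 'Im z < 0.
Definition upperHP (z : C) : Prop := 0 < 'Im z.

Definition cdiff_at (f : C -> C) (z : C) : Prop :=
  exists l : C, forall e : C, 0 < e -> exists d : C, 0 < d /\
    forall h : C, 0 < `|h| < d -> `|(f (z + h) - f z) / h - l| < e.

Definition mx_holo_on m n (D : C -> Prop) (F : C -> 'M[C]_(m, n)) : Prop :=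
  forall (i : 'I_m) (j : 'I_n) (z : C), D z -> cdiff_at (fun w => F w i j) z.

Definition discrete_in (D S : C -> Prop) : Prop :=
  forall z, D z -> exists r : C, 0 < r /\
    forall w, S w -> `|w - z| < r -> w = z.

Definition mx_mero_on m n (D S : C -> Prop) (F : C -> 'M[C]_(m, n)) : Prop :=
  (forall s, S s -> D s) /\ discrete_in D S /\
  mx_holo_on (fun z => D z /\ ~ S z) F /\
  forall s, S s -> exists (k : nat) (r : C), 0 < r /\
    exists G : C -> 'M[C]_(m, n), mx_holo_on (fun z => `|z - s| < r) G /\
      forall z, 0 < `|z - s| < r -> F z = (z - s) ^- k *: G z.

Definition mx_psd n (M : 'M[C]_n) : Prop :=
  forall v : 'cV[C]_n, 0 <= (mxstar v *m M *m v) 0 0.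
Definition mx_pd n (M : 'M[C]_n) : Prop :=
  forall v : 'cV[C]_n, v != 0 -> 0 < (mxstar v *m M *m v) 0 0.

Variable p : nat.

Definition jmx : 'M[C]_(p + p) := block_mx 1%:M 0 0 (- 1%:M).
Definition Jmx : 'M[C]_(p + p) := block_mx 0 1%:M 1%:M 0.
Definition Kmx : 'M[C]_(p + p) :=
  (sqrtC 2)^-1 *: block_mx 1%:M (- 1%:M) 1%:M 1%:M.

Variable beta : nat -> 'M[C]_(p, p + p).

Definition Cmx (k : nat) : 'M[C]_(p + p) :=
  2%:R *: (mxstar Kmx *m mxstar (beta k) *m beta k *m Kmx) - jmx.

Fixpoint Wmx (k : nat) (l : C) : 'M[C]_(p + p) :=
  match k with
  | 0 => 1%:M
  | k'.+1 => Wmx k' l - ('i / l) *: (jmx *m Cmx k' *m Wmx k' l)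
  end.

Definition Wcal (N : nat) (l : C) : 'M[C]_(p + p) :=
  Kmx *m mxstar (Wmx N.+1 (Num.conj l)).

Definition in_Nset (N : nat) (phi : C -> 'M[C]_p) : Prop :=
  mx_holo_on lowerHP phi /\
  exists (S : C -> Prop) (Rf Qf : C -> 'M[C]_p),
    mx_mero_on lowerHP S Rf /\ mx_mero_on lowerHP S Qf /\ ~ S (- 'i) /\
    (forall z, lowerHP z -> ~ S z ->
       mx_pd (mxstar (Rf z) *m Rf z + mxstar (Qf z) *m Qf z) /\
       mx_psd (mxstar (Qf z) *m Qf z - mxstar (Rf z) *m Rf z)) /\
    let A := fun z => ulsubmx (Wcal N z) *m Rf z + ursubmx (Wcal N z) *m Qf z in
    let B := fun z => dlsubmx (Wcal N z) *m Rf z + drsubmx (Wcal N z) *m Qf z in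
    (exists z0, lowerHP z0 /\ ~ S z0 /\ A z0 \in unitmx) /\
    (forall z, lowerHP z -> ~ S z -> A z \in unitmx ->
       phi z = 'i *: (B z *m invmx (A z))).

Definition qfun (l : C) : C := `|l| ^+ 2 / (`|l| ^+ 2 + 1).

Definition weyl_term (phi : C -> 'M[C]_p) (l : C) (k : nat) : 'M[C]_p :=
  row_mx ('i *: mxstar (phi l)) 1%:M *m
  (qfun l ^+ k *: (Kmx *m mxstar (Wmx k l) *m Cmx k *m Wmx k l *m mxstar Kmx))
  *m col_mx (- 'i *: phi l) 1%:M.

Definition weyl_series_cvg (phi : C -> 'M[C]_p) (l : C) : Prop :=
  exists L : 'M[C]_p, forall (a b : 'I_p) (e : C), 0 < e ->
    exists M : nat, forall n : nat, (M <= n)%N ->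
      `|(\sum_(k < n) weyl_term phi l k) a b - L a b| < e.

End Defs.

(* Main.v *)
Require Import Defs.
From mathcomp Require Import all_boot all_order all_algebra.
From mathcomp Require Import reals.
From mathcomp.real_closed Require Import complex.
From mathcomp Require Import ring.
From mathcomp Require Import boolp classical_sets filter.
Import GRing.Theory Num.Theory Order.TTheory.
Local Open Scope ring_scope.

Set Implicit Arguments.
Unset Strict Implicit.
Unset Printing Implicit Defensive.

(* Everything happens at a fixed l in the upper half-plane.  Since C_k j C_k = j
   and C_k > 0, the fluxes g_k(u) = q^k u^* W_k^* j W_k u satisfy
   g_{k+1} = g_k - q kap f_k, where f_k(u) = q^k u^* W_k^* C_k W_k u is the energy
   and kap = 2 Im l / |l|^2 > 0; so the series telescopes, and it converges for u
   as soon as all g_{k+1}(u) are nonnegative.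

   Existence.  Put X = [-i psi(l); I].  The representation of phi_inf in N(N) says
   that W_{N+1}(l) K^* X x is orthogonal to the range of [R; Q].  That range is
   a maximal j-nonpositive subspace, hence g_{N+1}(K^* X x) >= 0.  The denominator
   W_11 R + W_12 Q is invertible at every point that is not a pole, because
   W_{N+1}^* maps nonzero j-nonpositive vectors to j-negative ones; the poles are
   reached by continuity.

   Uniqueness.  As C_k + j >= 0, f_k >= -g_k >= -u^* j u, so a vector of finite
   energy has u^* j u >= 0.  If two functions had different values at l, the
   vectors of finite energy would contain K^* [-i psi d - s d; d] for some d != 0
   and every s > 0, whose j-form tends to -oo with s. *)

(** * Conjugate transposes and the Hermitian inner product *)

Section HermitianForm.
Variable R : realType.
Local Notation C := (R[i]).

Lemma mxstarM m n q (A : 'M[C]_(m, n)) (B : 'M[C]_(n, q)) :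
  mxstar (A *m B) = mxstar B *m mxstar A.
Proof. by rewrite /mxstar map_mxM trmx_mul. Qed.

Lemma mxstarK m n : cancel (@mxstar R m n) (@mxstar R n m).
Proof. by move=> A; apply/matrixP => i j; rewrite !mxE conjCK. Qed.

Lemma mxstarD m n (A B : 'M[C]_(m, n)) : mxstar (A + B) = mxstar A + mxstar B.
Proof. by rewrite /mxstar map_mxD linearD. Qed.

Lemma mxstarZ m n (a : C) (A : 'M[C]_(m, n)) :
  mxstar (a *: A) = a^* *: mxstar A.
Proof. by rewrite /mxstar map_mxZ linearZ. Qed.

Lemma mxstarN m n (A : 'M[C]_(m, n)) : mxstar (- A) = - mxstar A.
Proof. by rewrite /mxstar map_mxN linearN. Qed.

Lemma mxstar1 n : mxstar (1%:M : 'M[C]_n) = 1%:M.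
Proof. by rewrite /mxstar map_mx1 trmx1. Qed.

Lemma mxstar0 m n : mxstar (0 : 'M[C]_(m, n)) = 0.
Proof. by rewrite /mxstar map_mx0 trmx0. Qed.

Lemma mxstar_row m n1 n2 (A : 'M[C]_(m, n1)) (B : 'M[C]_(m, n2)) :
  mxstar (row_mx A B) = col_mx (mxstar A) (mxstar B).
Proof. by rewrite /mxstar map_row_mx tr_row_mx. Qed.

Lemma mxstar_col m1 m2 n (A : 'M[C]_(m1, n)) (B : 'M[C]_(m2, n)) :
  mxstar (col_mx A B) = row_mx (mxstar A) (mxstar B).
Proof. by rewrite /mxstar map_col_mx tr_col_mx. Qed.

Lemma mxstar_block m1 m2 n1 n2 (A : 'M[C]_(m1, n1)) (B : 'M[C]_(m1, n2))
    (D : 'M[C]_(m2, n1)) (E : 'M[C]_(m2, n2)) :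
  mxstar (block_mx A B D E) =
  block_mx (mxstar A) (mxstar D) (mxstar B) (mxstar E).
Proof. by rewrite /mxstar map_block_mx tr_block_mx. Qed.

Definition hdot n (u v : 'cV[C]_n) : C := (mxstar u *m v) 0 0.

Lemma hdotDl n (u v w : 'cV[C]_n) : hdot (u + v) w = hdot u w + hdot v w.
Proof. by rewrite /hdot mxstarD mulmxDl mxE. Qed.

Lemma hdotDr n (u v w : 'cV[C]_n) : hdot u (v + w) = hdot u v + hdot u w.
Proof. by rewrite /hdot mulmxDr mxE. Qed.

Lemma hdotZl n a (u v : 'cV[C]_n) : hdot (a *: u) v = a^* * hdot u v.
Proof. by rewrite /hdot mxstarZ -scalemxAl mxE. Qed.

Lemma hdotZr n a (u v : 'cV[C]_n) : hdot u (a *: v) = a * hdot u v.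
Proof. by rewrite /hdot -scalemxAr mxE. Qed.

Lemma hdotNl n (u v : 'cV[C]_n) : hdot (- u) v = - hdot u v.
Proof. by rewrite -scaleN1r hdotZl rmorphN1 mulN1r. Qed.

Lemma hdotNr n (u v : 'cV[C]_n) : hdot u (- v) = - hdot u v.
Proof. by rewrite -scaleN1r hdotZr mulN1r. Qed.

Lemma hdot0r n (u : 'cV[C]_n) : hdot u 0 = 0.
Proof. by rewrite /hdot mulmx0 mxE. Qed.

Lemma hdot_conj n (u v : 'cV[C]_n) : (hdot u v)^* = hdot v u.
Proof. by rewrite /hdot -[u in RHS]mxstarK -mxstarM !mxE. Qed.

Lemma hdotMl m n (A : 'M[C]_(m, n)) (u : 'cV[C]_n) v :
  hdot (A *m u) v = hdot u (mxstar A *m v).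
Proof. by rewrite /hdot mxstarM mulmxA. Qed.

Lemma hdotMr m n (A : 'M[C]_(m, n)) (u : 'cV[C]_n) v :
  hdot v (A *m u) = hdot (mxstar A *m v) u.
Proof. by rewrite hdotMl mxstarK. Qed.

Lemma hdot_col m n (u u' : 'cV[C]_m) (v v' : 'cV[C]_n) :
  hdot (col_mx u v) (col_mx u' v') = hdot u u' + hdot v v'.
Proof. by rewrite /hdot mxstar_col mul_row_col mxE. Qed.

Lemma hdotxx n (u : 'cV[C]_n) : hdot u u = \sum_i `|u i 0| ^+ 2.
Proof. by rewrite /hdot mxE; apply: eq_bigr => i _; rewrite !mxE normCKC. Qed.

Lemma hdot_ge0 n (u : 'cV[C]_n) : 0 <= hdot u u.
Proof. by rewrite hdotxx sumr_ge0 // => i _; rewrite exprn_ge0. Qed.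

Lemma hdot_eq0 n (u : 'cV[C]_n) : (hdot u u == 0) = (u == 0).
Proof.
apply/idP/eqP => [|->]; last by rewrite hdot0r.
rewrite hdotxx psumr_eq0 => [/allP h|i _]; last by rewrite exprn_ge0.
apply/matrixP => i j; rewrite ord1 mxE.
by have := h i (mem_index_enum _); rewrite sqrf_eq0 normr_eq0 => /eqP.
Qed.

Lemma hdot_gt0 n (u : 'cV[C]_n) : (0 < hdot u u) = (u != 0).
Proof. by rewrite lt_def hdot_ge0 andbT hdot_eq0. Qed.

Lemma formE n (M : 'M[C]_n) v : (mxstar v *m M *m v) 0 0 = hdot v (M *m v).
Proof. by rewrite /hdot mulmxA. Qed.

Lemma unitmx_ker0 n (A : 'M[C]_n) :
  (forall u : 'cV_n, A *m u = 0 -> u = 0) -> A \in unitmx.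
Proof.
move=> h; rewrite -unitmx_tr -row_free_unit -kermx_eq0; apply/rowV0P => v.
move/sub_kermxP => hv; apply: trmx_inj; rewrite trmx0; apply: h.
by apply: trmx_inj; rewrite trmx_mul trmxK hv trmx0.
Qed.

Lemma form_real n (M : 'M[C]_n) v : mxstar M = M -> hdot v (M *m v) \is Num.real.
Proof. by move=> hM; rewrite CrealE hdot_conj hdotMl hM. Qed.

End HermitianForm.

(** * Algebra of the matrices j, J and K *)

Section Structure.
Variables (R : realType) (p : nat).
Local Notation C := (R[i]).
Local Notation j := (jmx R p).
Local Notation J := (Jmx R p).
Local Notation K := (Kmx R p).

Lemma jmxK : j *m j = 1%:M.
Proof.
by rewrite mulmx_block !mulmx1 !mul0mx !mulmx0 mulmxN mulmx1 opprK
  !addr0 add0r -scalar_mx_block.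
Qed.

Lemma mxstar_j : mxstar j = j.
Proof. by rewrite mxstar_block mxstarN !mxstar0 !mxstar1. Qed.

Lemma mul_j_col (u v : 'cV[C]_p) : j *m col_mx u v = col_mx u (- v).
Proof. by rewrite mul_block_col !mul0mx mulNmx !mul1mx addr0 add0r. Qed.

Lemma mul_J_col (u v : 'cV[C]_p) : J *m col_mx u v = col_mx v u.
Proof. by rewrite mul_block_col !mul0mx !mul1mx addr0 add0r. Qed.

Lemma sqrtC2_conj : ((sqrtC 2)^-1 : C)^* = (sqrtC 2)^-1.
Proof. by apply/CrealP/ger0_real; rewrite invr_ge0 sqrtC_ge0 ler0n. Qed.

Lemma sqrtC2_sqr : ((sqrtC 2)^-1 : C) * (sqrtC 2)^-1 = 2^-1.
Proof. by rewrite -expr2 exprVn sqrtCK. Qed.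


Lemma scale_halfD (A : 'M[C]_p) : 2^-1 *: (A + A) = A.
Proof.
rewrite scalerDr -scalerDl; have -> : 2^-1 + 2^-1 = 1 :> C by field.
by rewrite scale1r.
Qed.

Lemma mulKK_star : K *m mxstar K = 1%:M.
Proof.
rewrite mxstarZ sqrtC2_conj -scalemxAl -scalemxAr scalerA sqrtC2_sqr.
rewrite mxstar_block !mxstarN !mxstar1 mulmx_block.
rewrite !(mulNmx, mulmxN, mul1mx, opprK, addrN).
by rewrite scale_block_mx scaler0 scale_halfD -scalar_mx_block.
Qed.

Lemma Kstar_J_K : mxstar K *m J *m K = j.
Proof.
rewrite mxstarZ sqrtC2_conj -scalemxAl -scalemxAr -scalemxAl scalerA sqrtC2_sqr.
rewrite mxstar_block !mxstarN !mxstar1 !mulmx_block.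
rewrite !(mulNmx, mulmxN, mul1mx, mulmx0, mulmx1, opprK, addrN, addNr, addr0, add0r).
by rewrite -opprD scale_block_mx scaler0 scalerN !scale_halfD.
Qed.

Lemma hdot_K_J u : hdot (K *m u) (J *m (K *m u)) = hdot u (j *m u).
Proof. by rewrite hdotMl !mulmxA Kstar_J_K. Qed.

Lemma hdot_Kstar_j u : hdot (mxstar K *m u) (j *m (mxstar K *m u)) = hdot u (J *m u).
Proof.
by rewrite -hdot_K_J mulmxA mulKK_star mul1mx.
Qed.

End Structure.

(** * The coefficients C_k: j-unitarity and positivity *)

Section System.
Variables (R : realType) (p : nat).
Local Notation C := (R[i]).
Local Notation j := (jmx R p).
Local Notation J := (Jmx R p).
Local Notation K := (Kmx R p).
Variable beta : nat -> 'M[C]_(p, p + p).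
Hypothesis betaJ : forall k, beta k *m J *m mxstar (beta k) = 1%:M.
Local Notation b k := (beta k *m K).
Local Notation W := (Wmx beta).

Lemma CmxE k : Cmx beta k = 2%:R *: (mxstar (b k) *m b k) - j.
Proof. by rewrite /Cmx mxstarM !mulmxA. Qed.

Lemma bjb k : b k *m j *m mxstar (b k) = 1%:M.
Proof.
rewrite -(Kstar_J_K R p) mxstarM !mulmxA -[beta k *m K *m mxstar K]mulmxA
  mulKK_star mulmx1.
rewrite -[_ *m K *m mxstar K]mulmxA mulKK_star mulmx1; exact: betaJ.
Qed.

Lemma mxstar_C k : mxstar (Cmx beta k) = Cmx beta k.
Proof.
by rewrite CmxE mxstarD mxstarN mxstar_j mxstarZ mxstarM mxstarK rmorph_nat.
Qed.

(** Write C_k = 2P - j with P = b^* b. From b j b^* = I follows P j P = P, so the product is 4P - 2P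
    - 2P + j. *)
Lemma CjC k : Cmx beta k *m j *m Cmx beta k = j.
Proof.
rewrite CmxE; set B := b k; set P := mxstar B *m B.
have PjP : P *m j *m P = P.
  have -> : P *m j *m P = mxstar B *m (B *m j *m mxstar B) *m B by rewrite !mulmxA.
  by rewrite bjb mulmx1.
rewrite mulmxBl jmxK mulmxBr !mulmxBl -!scalemxAl -!scalemxAr scalerA PjP.
rewrite -mulmxA jmxK mulmx1 mul1mx -natrM.
have -> : 4%:R *: P = 2%:R *: P + 2%:R *: P :> 'M[C]__ by rewrite -scalerDl -natrD.
by rewrite mul1mx addrK opprB addrC subrK.
Qed.

Lemma hdot_CjC k u : hdot (j *m (Cmx beta k *m u)) (Cmx beta k *m u) = hdot u (j *m u).
Proof.
by rewrite [LHS]hdotMl mxstar_j hdotMl mxstar_C !mulmxA CjC.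
Qed.

(** C_k + j = 2 b^* b. *)
Lemma hdot_CDj_ge0 k v : 0 <= hdot v (Cmx beta k *m v) + hdot v (j *m v).
Proof.
rewrite -hdotDr -mulmxDl CmxE subrK -scalemxAl hdotZr -mulmxA -hdotMl.
by rewrite mulr_ge0 ?ler0n ?hdot_ge0.
Qed.

(* With w := v - j b^* b v, which lies in ker b, and y such that b1^* y = w1:
   v^* C v = |b v|^2 + |y|^2 + |b2^* y + w2|^2. *)
Lemma C_pos k v : v != 0 -> 0 < hdot v (Cmx beta k *m v).
Proof.
move=> v0; pose B := b k; pose b1 := lsubmx B; pose b2 := rsubmx B.
have bjB : B *m j *m mxstar B = 1%:M by exact: bjb.
have Be : B = row_mx b1 b2 by rewrite hsubmxK.
have bb : b1 *m mxstar b1 - b2 *m mxstar b2 = 1%:M.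
  rewrite -(bjb k) -/B Be mxstar_row mul_row_block !mulmx0 addr0 add0r.
  by rewrite mul_row_col mulmx1 mulmxN mulmx1 mulNmx.
have sq y : hdot (mxstar b1 *m y) (mxstar b1 *m y)
          = hdot y y + hdot (mxstar b2 *m y) (mxstar b2 *m y).
  have -> : hdot y y = hdot y ((b1 *m mxstar b1 - b2 *m mxstar b2) *m y).
    by rewrite bb mul1mx.
  by rewrite !hdotMl !mxstarK !mulmxA mulmxBl hdotDr hdotNr subrK.
(* By [sq], |b1^* y|^2 = |y|^2 + |b2^* y|^2, so b1^* is injective. *)
have ub1 : mxstar b1 \in unitmx.
  apply: unitmx_ker0 => y y0; apply/eqP; rewrite -hdot_eq0.
  have := sq y; rewrite y0 hdot0r => /esym/eqP.
  by rewrite paddr_eq0 ?hdot_ge0// => /andP[].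
pose u := B *m v; have [w wE] : exists w, w = v - j *m (mxstar B *m u) by eexists.
have Bw : B *m w = 0 by rewrite wE mulmxBr !mulmxA bjB mul1mx subrr.
pose w1 := usubmx w; pose w2 := dsubmx w.
have we : w = col_mx w1 w2 by rewrite vsubmxK.
pose y := invmx (mxstar b1) *m w1.
have y1 : mxstar b1 *m y = w1 by rewrite mulKVmx.
have bw : b1 *m w1 = - (b2 *m w2).
  by apply/eqP; rewrite -addr_eq0 -mul_row_col -Be -we Bw.
pose t := mxstar b2 *m y + w2.
(* Since b1 w1 = - b2 w2, both cross terms of |t|^2 equal -|w1|^2. *)
have yw : hdot y (b2 *m w2) = - hdot w1 w1.
  by rewrite -{1}y1 hdotMl mxstarK bw hdotNr opprK.
have yw' : hdot w2 (mxstar b2 *m y) = - hdot w1 w1.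
  by rewrite -[LHS]hdot_conj hdotMl mxstarK yw -[in RHS]hdot_conj rmorphN.
have wjw : - hdot w (j *m w) = hdot y y + hdot t t.
  rewrite we mul_j_col hdot_col hdotNr /t !hdotDl !hdotDr yw'.
  rewrite [hdot (_ *m y) w2]hdotMl mxstarK yw.
  have := sq y; rewrite y1 => ->.
  by move: (hdot y y) (hdot w2 w2) (hdot _ _) => a1 a2 a3; ring.
have Cv : hdot v (Cmx beta k *m v) = hdot u u + (hdot y y + hdot t t).
  have ve : v = j *m (mxstar B *m u) + w by rewrite wE addrC subrK.
  have e1 : hdot v (j *m v) = hdot u u + hdot w (j *m w).
    have ja : j *m (j *m (mxstar B *m u)) = mxstar B *m u.
      by rewrite mulmxA jmxK mul1mx.
    have aa : hdot (j *m (mxstar B *m u)) (mxstar B *m u) = hdot u u.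
      by rewrite hdotMr mxstarK !mulmxA bjB mul1mx.
    have aw : hdot (j *m (mxstar B *m u)) (j *m w) = 0.
      by rewrite hdotMr mxstar_j ja hdotMl mxstarK Bw hdot0r.
    have wa : hdot w (mxstar B *m u) = 0.
      by rewrite -hdot_conj hdotMl mxstarK Bw hdot0r conjC0.
    by rewrite ve mulmxDr ja !hdotDl !hdotDr aa aw wa addr0 add0r.
  rewrite CmxE mulmxBl hdotDr hdotNr e1 -wjw -scalemxAl hdotZr -mulmxA -hdotMl -/B -/u.
  by move: (hdot u u) (hdot _ _) => a1 a2; ring.
rewrite lt_def Cv !addr_ge0 ?hdot_ge0 ?andbT//; apply: contraNneq v0 => /eqP.
rewrite paddr_eq0 ?addr_ge0 ?hdot_ge0// paddr_eq0 ?hdot_ge0// !hdot_eq0.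
move=> /and3P[/eqP u0 /eqP y0 /eqP t0].
have w0 : w = 0.
  by rewrite we -y1 y0 mulmx0; move: t0; rewrite /t y0 mulmx0 add0r => ->;
    rewrite col_mx0.
by rewrite -[v](subrK (j *m (mxstar B *m u))) -wE w0 u0 !mulmx0 addr0.
Qed.

End System.

(** * Scalar factors depending on the spectral parameter *)

Lemma addC_conj_i_div (F : numClosedFieldType) (z : F) :
  'i / z + ('i / z)^* = 2 * 'Im z / (z * z^*).
Proof.
have [->|z0] := eqVneq z 0; first by rewrite invr0 mul0r !mulr0 conjC0 invr0 addr0 mulr0.
have zc0 : z^* != 0 by rewrite conjC_eq0.
have e : z^* - z = - (2 * 'i * 'Im z).
  by rewrite {1 2}[z]Crect conjC_rect ?Creal_Re ?Creal_Im//; ring.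
have -> : 'i / z + ('i / z)^* = 'i * (z^* - z) / (z * z^*).
  by rewrite rmorphM fmorphV /= conjCi; field; rewrite z0 zc0.
(* [ring] treats ['i] as an indeterminate, so the relation ['i ^+ 2 = -1] is inserted by hand. *)
by congr (_ / _); rewrite e -[2]opprK -[RHS]mul1r -[1]opprK -(sqrCi F); ring.
Qed.

Section SpectralParameter.
Variables (R : realType) (l : R[i]).
Local Notation C := (R[i]).
Hypothesis l_up : upperHP l.

(** For a = i/z, one step of the system multiplies the j-form by [rhofun] and subtracts [kapfun]
    times the form of C_k. As [rhofun] is 1 + 1/|z|^2, the weight q compensates it exactly. *)
Definition rhofun (z : C) : C := 1 + ('i / z) * ('i / z)^*.
Definition kapfun (z : C) : C := 'i / z + ('i / z)^*.

Lemma upperHP_neq0 : l != 0.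
Proof. by apply/eqP => l0; move: l_up; rewrite /upperHP l0 raddf0 ltxx. Qed.

Lemma qfun_rho : qfun l * rhofun l = 1.
Proof.
have l0 := upperHP_neq0.
have n0 : `|l| ^+ 2 != 0 by rewrite expf_eq0 normr_eq0.
have n1 : `|l| ^+ 2 + 1 != 0 by rewrite gt_eqF// ltr_wpDl// exprn_ge0.
rewrite /qfun /rhofun -normCK normf_div normCi expr_div_n expr1n.
by move: `|l| n0 n1 => t n0 n1; field; rewrite n1 andbT; move: n0; rewrite expf_eq0.
Qed.

Lemma qfun_gt0 : 0 < qfun l.
Proof.
by rewrite divr_gt0 ?exprn_gt0 ?normr_gt0 ?upperHP_neq0// ltr_wpDl// exprn_ge0.
Qed.

Lemma rho_gt0 : 0 < rhofun l.
Proof. by rewrite ltr_wpDr// mul_conjC_ge0. Qed.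

Lemma kap_gt0 : 0 < kapfun l.
Proof.
have l0 := upperHP_neq0.
rewrite /kapfun addC_conj_i_div.
by rewrite divr_gt0 ?mul_conjC_gt0 ?upperHP_neq0// mulr_gt0 ?ltr0n.
Qed.
End SpectralParameter.

(** Nonnegative elements of [R[i]] are real, so x / d can be compared with integers in [R]. *)
Lemma complex_archi (R : realType) (x d : R[i]) :
  0 <= x -> 0 < d -> exists n : nat, x < d *+ n.
Proof.
move=> x0 d0; have xd0 : 0 <= x / d by rewrite divr_ge0// ltW.
have /complex_realP[r rE] := ger0_real xd0.
have r0 : 0 <= r by rewrite -ler0c -rE.
exists (Num.bound r); rewrite -mulr_natr -ltr_pdivrMl// mulrC rE.
by have := archi_boundP r0; rewrite -ltcR rmorph_nat.
Qed.

(** * Energy and flux along the system *)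

Section Dynamics.
Variables (R : realType) (p : nat).
Local Notation C := (R[i]).
Local Notation j := (jmx R p).
Local Notation J := (Jmx R p).
Local Notation K := (Kmx R p).
Variable beta : nat -> 'M[C]_(p, p + p).
Hypothesis betaJ : forall k, beta k *m J *m mxstar (beta k) = 1%:M.
Local Notation W := (Wmx beta).

(** In the expansion, j j = I reduces the cross terms to the form of C_k, and C_k j C_k = j turns
    the quadratic term back into the j-form. *)
Lemma j_form_step k (a : C) w :
  hdot (w - a *: (j *m Cmx beta k *m w)) (j *m (w - a *: (j *m Cmx beta k *m w)))
  = (1 + a * a^*) * hdot w (j *m w) - (a + a^*) * hdot w (Cmx beta k *m w).
Proof.
rewrite -!mulmxA mulmxBr -scalemxAr [j *m (j *m _)]mulmxA jmxK mul1mx.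
rewrite !(hdotDl, hdotDr, hdotNl, hdotNr, hdotZl, hdotZr) hdot_CjC//.
have -> : hdot (j *m (Cmx beta k *m w)) (j *m w) = hdot w (Cmx beta k *m w).
  by rewrite !hdotMl mxstar_j mxstar_C [j *m (j *m _)]mulmxA jmxK mul1mx.
by move: (hdot _ _) (hdot _ _) (a^*) => x y z; ring.
Qed.

Lemma mul_WS k l (u : 'cV_(p + p)) :
  W k.+1 l *m u = W k l *m u - ('i / l) *: (j *m Cmx beta k *m (W k l *m u)).
Proof. by rewrite [W k.+1 l]/= mulmxBl -scalemxAl -!mulmxA. Qed.

Lemma j_form_W k l (u : 'cV_(p + p)) :
  hdot (W k.+1 l *m u) (j *m (W k.+1 l *m u)) =
  rhofun l * hdot (W k l *m u) (j *m (W k l *m u))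
  - kapfun l * hdot (W k l *m u) (Cmx beta k *m (W k l *m u)).
Proof. by rewrite mul_WS j_form_step. Qed.

Definition energy l k u :=
  qfun l ^+ k * hdot (W k l *m u) (Cmx beta k *m (W k l *m u)).
Definition jflux l k u := qfun l ^+ k * hdot (W k l *m u) (j *m (W k l *m u)).

Lemma energy_ge0 l k u : 0 <= energy l k u.
Proof.
rewrite mulr_ge0//.
  by rewrite exprn_ge0// /qfun divr_ge0 ?addr_ge0 ?exprn_ge0.
have [->|u0] := eqVneq (W k l *m u) 0; first by rewrite mulmx0 hdot0r.
exact/ltW/C_pos.
Qed.

Lemma jfluxS l k u : upperHP l ->
  jflux l k.+1 u = jflux l k u - qfun l * kapfun l * energy l k u.
Proof.
move=> /qfun_rho; rewrite /jflux j_form_W /energy exprSr.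
move: (qfun l) (rhofun l) (kapfun l) (_ ^+ k) (hdot _ _) (hdot _ _).
move=> a b c d x y ab1; rewrite -[d * y]mul1r -ab1; ring.
Qed.

Lemma energy_sum l n u : upperHP l ->
  qfun l * kapfun l * (\sum_(k < n) energy l k u) = hdot u (j *m u) - jflux l n u.
Proof.
move=> lu; elim: n => [|n IH].
  by rewrite big_ord0 mulr0 /jflux expr0 mul1r mul1mx subrr.
by rewrite big_ord_recr /= mulrDr IH jfluxS// opprB addrA [LHS]addrAC.
Qed.

(** Parallelogram law, with the nonnegative energy of u - v dropped. *)
Lemma energy_parallelogram l n (u v : 'cV[C]_(p + p)) :
  \sum_(k < n) energy l k (u + v) <=
  2 * (\sum_(k < n) energy l k u) + 2 * (\sum_(k < n) energy l k v).
Proof.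
rewrite !mulr_sumr -big_split ler_sum//= => k _.
suff -> : 2 * energy l k u + 2 * energy l k v
        = energy l k (u + v) + energy l k (u - v) by rewrite lerDl energy_ge0.
rewrite /energy !(mulmxDr, mulmxN) !(hdotDl, hdotDr, hdotNl, hdotNr).
by move: (_ ^+ k) (hdot _ _) (hdot _ _) (hdot _ _) (hdot _ _) => a x y z t; ring.
Qed.

(** Energies are nonnegative, so bounded partial sums amount to convergence; in this form closure
    under addition needs no limits. *)
Definition energy_bounded l u :=
  exists M : C, forall n, \sum_(k < n) energy l k u <= M.

Lemma energy_boundedD l (u v : 'cV[C]_(p + p)) :
  energy_bounded l u -> energy_bounded l v -> energy_bounded l (u + v).
Proof.
move=> [M1 h1] [M2 h2]; exists (2 * M1 + 2 * M2) => n.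
apply: le_trans (energy_parallelogram _ _ _ _) _.
exact: lerD (ler_wpM2l (ler0n _ _) (h1 n)) (ler_wpM2l (ler0n _ _) (h2 n)).
Qed.

(** If u^* j u were negative, every energy term would be at least the positive number - u^* j u, and
    the partial sums would grow linearly. *)
Lemma energy_bounded_ge0 l u : upperHP l ->
  energy_bounded l u -> 0 <= hdot u (j *m u).
Proof.
move=> lu [M hM].
have kap0 : 0 < qfun l * kapfun l by rewrite mulr_gt0 ?qfun_gt0 ?kap_gt0.
have rj : hdot u (j *m u) \is Num.real by rewrite form_real ?mxstar_j.
rewrite real_leNgt ?real0//; apply/negP => neg.
have fle n : jflux l n u <= hdot u (j *m u).
  rewrite -subr_ge0 -energy_sum//; apply: mulr_ge0; first exact: ltW.
  by apply: sumr_ge0 => k _; exact: energy_ge0.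
have ege n : - hdot u (j *m u) <= energy l n u.
  apply: (@le_trans _ _ (- jflux l n u)); first by rewrite lerN2.
  rewrite -subr_ge0 opprK /energy /jflux -mulrDr; apply: mulr_ge0.
    by rewrite exprn_ge0// ltW// qfun_gt0.
  exact: hdot_CDj_ge0.
have sge n : - hdot u (j *m u) *+ n <= M.
  apply: le_trans (hM n); rewrite -[n in _ *+ n]card_ord -sumr_const.
  by apply: ler_sum => k _.
have M0 : 0 <= M by rewrite (le_trans _ (sge 0%N)) ?mulr0n.
have [||n hn] := @complex_archi R M (- hdot u (j *m u)) => //; first by rewrite oppr_gt0.
by move: (lt_le_trans hn (sge n)); rewrite ltxx.
Qed.

(** The adjoint reverses the order of the factors: the one of index k acts first on u. Inductions on
    k must therefore generalize over the vector. *)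
Lemma mul_WSstar k l (u : 'cV_(p + p)) :
  mxstar (W k.+1 l) *m u =
  mxstar (W k l) *m (u - ('i / l)^* *: (Cmx beta k *m (j *m u))).
Proof.
rewrite [W k.+1 l]/= mxstarD mxstarN mxstarZ !mxstarM mxstar_j mxstar_C.
by rewrite mulmxBl mulmxBr -scalemxAl -scalemxAr -!mulmxA.
Qed.

(** Dual of [j_form_step]: after the substitution v = j u the same two identities apply, and the
    form of C_k is taken at v. *)
Lemma j_form_star_step k (a : C) (u : 'cV_(p + p)) :
  let v := u - a^* *: (Cmx beta k *m (j *m u)) in
  hdot v (j *m v) = (1 + a * a^*) * hdot u (j *m u)
  - (a + a^*) * hdot (j *m u) (Cmx beta k *m (j *m u)).
Proof.
rewrite /=; have [v vE] : exists v, v = j *m u by eexists.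
have -> : u = j *m v by rewrite vE mulmxA jmxK mul1mx.
rewrite [j *m (j *m v)]mulmxA jmxK mul1mx mulmxBr -scalemxAr
  [j *m (j *m v)]mulmxA jmxK mul1mx.
rewrite !(hdotDl, hdotDr, hdotNl, hdotNr, hdotZl, hdotZr) conjCK.
have -> : hdot (j *m v) (j *m (Cmx beta k *m v)) = hdot v (Cmx beta k *m v).
  by rewrite [LHS]hdotMl mxstar_j mulmxA jmxK mul1mx.
have -> : hdot (Cmx beta k *m v) v = hdot v (Cmx beta k *m v).
  by rewrite [LHS]hdotMl mxstar_C.
have -> : hdot (Cmx beta k *m v) (j *m (Cmx beta k *m v)) = hdot v (j *m v).
  by rewrite -[RHS](hdot_CjC betaJ k) [RHS]hdotMl mxstar_j.
have -> : hdot (j *m v) v = hdot v (j *m v) by rewrite [LHS]hdotMl mxstar_j.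
by move: (hdot _ _) (hdot _ _) (a^*) => x y z; ring.
Qed.

(** The first factor applied makes the form strictly negative, because C_n > 0 and [kapfun l] > 0;
    the remaining ones keep it so. At index 0 the matrix is I and strictness would fail, whence
    [n.+1]. *)
Lemma Wstar_neg n l u : upperHP l -> u != 0 -> hdot u (j *m u) <= 0 ->
  hdot (mxstar (W n.+1 l) *m u) (j *m (mxstar (W n.+1 l) *m u)) < 0.
Proof.
move=> lu.
have step k v : v != 0 -> hdot v (j *m v) <= 0 ->
    let v' := v - ('i / l)^* *: (Cmx beta k *m (j *m v)) in
    hdot v' (j *m v') < 0.
  move=> v0 neg /=; rewrite j_form_star_step subr_lt0.
  apply: (@le_lt_trans _ _ 0).
    by rewrite mulr_ge0_le0// ltW// rho_gt0.
  rewrite mulr_gt0 ?kap_gt0// C_pos//; apply: contraNneq v0 => jv0.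
  by rewrite -[v]mul1mx -(jmxK R p) -mulmxA jv0 mulmx0.
have neg_neq0 v : hdot v (j *m v) < 0 -> v != 0.
  by apply: contraTneq => ->; rewrite mulmx0 hdot0r ltxx.
have ind m v : hdot v (j *m v) < 0 ->
    hdot (mxstar (W m l) *m v) (j *m (mxstar (W m l) *m v)) < 0.
  elim: m v => [|m IH] v neg; first by rewrite /= mxstar1 mul1mx.
  by rewrite mul_WSstar; apply/IH/step; rewrite ?neg_neq0// ltW.
by move=> u0 neg; rewrite mul_WSstar; apply/ind/step.
Qed.

(** The vector K^* X x with X = [-i P; I], where P is a candidate value of the Weyl function. *)
Definition weyl_vec (P : 'M[C]_p) (x : 'cV[C]_p) : 'cV[C]_(p + p) :=
  mxstar K *m col_mx ((- 'i) *: (P *m x)) x.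

Lemma hdot_weyl_term phi l k x :
  hdot x (weyl_term beta phi l k *m x) = energy l k (weyl_vec (phi l) x).
Proof.
rewrite /weyl_term; set X := col_mx _ _.
have -> : row_mx ('i *: mxstar (phi l)) 1%:M = mxstar X.
  by rewrite mxstar_col mxstarZ rmorphN /= conjCi opprK mxstar1.
have -> : weyl_vec (phi l) x = mxstar K *m (X *m x).
  by rewrite /weyl_vec mul_col_mx mul1mx -scalemxAl.
rewrite /energy -!mulmxA hdotMr mxstarK -scalemxAl hdotZr; congr (_ * _).
by rewrite -!mulmxA hdotMr [in LHS]hdotMr mxstarK !mulmxA.
Qed.

(** * The linear-fractional representation at a single point *)

Section LinearFractional.
Variables (l : C) (n : nat) (Rm Qm : 'M[C]_p).
Hypothesis l_up : upperHP l.
Hypothesis pd : mx_pd (mxstar Rm *m Rm + mxstar Qm *m Qm).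
Hypothesis psd : mx_psd (mxstar Qm *m Qm - mxstar Rm *m Rm).
(** This is [Wcal] of index n at the conjugate of l, a point of the lower half-plane where [Rm] and
    [Qm] are values of R and Q. *)
Let Wc := K *m mxstar (W n.+1 l).
Let A := ulsubmx Wc *m Rm + ursubmx Wc *m Qm.
Let B := dlsubmx Wc *m Rm + drsubmx Wc *m Qm.

Let pd' (u : 'cV_p) : u != 0 -> 0 < hdot (Rm *m u) (Rm *m u) + hdot (Qm *m u) (Qm *m u).
Proof.
by move/pd; rewrite formE mulmxDl hdotDr -!mulmxA -!hdotMl.
Qed.

Let psd' (u : 'cV_p) : hdot (Rm *m u) (Rm *m u) <= hdot (Qm *m u) (Qm *m u).
Proof.
by have := psd u; rewrite formE mulmxBl hdotDr hdotNr -!mulmxA -!hdotMl subr_ge0.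
Qed.

Let Wc_col (u : 'cV_p) :
  K *m (mxstar (W n.+1 l) *m col_mx (Rm *m u) (Qm *m u)) =
  col_mx (A *m u) (B *m u).
Proof.
by rewrite mulmxA -/Wc -[Wc in LHS]submxK mul_block_col !mulmxA -!mulmxDl.
Qed.

(** If A u = 0, then K W^* [R u; Q u] = [0; B u] is J-neutral, whereas [Wstar_neg] makes its J-form
    negative unless u = 0. *)
Lemma lft_denominator_unit : A \in unitmx.
Proof.
apply: unitmx_ker0 => u Au; apply/eqP; apply: contraT => u0.
pose z := col_mx (Rm *m u) (Qm *m u).
have z0 : z != 0 by rewrite -hdot_gt0 hdot_col pd'.
have zneg : hdot z (j *m z) <= 0 by rewrite mul_j_col hdot_col hdotNr subr_le0 psd'.
have := Wstar_neg n l_up z0 zneg.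
rewrite -hdot_K_J Wc_col Au mul_J_col hdot_col hdot0r -hdot_conj hdot0r conjC0.
by rewrite addr0 ltxx.
Qed.

Lemma lft_flux_ge0 (P : 'M[C]_p) x Y : P = 'i *: (B *m invmx A) ->
  Y = W n.+1 l *m weyl_vec (mxstar P) x -> 0 <= hdot Y (j *m Y).
Proof.
move=> PE YE; have PA : P *m A = 'i *: B.
  by rewrite PE -scalemxAl mulmxKV// lft_denominator_unit.
pose y1 := usubmx Y; pose y2 := dsubmx Y.
(* Moving W and K^* to the other side gives i x^* P A u + x^* B u, which vanishes because P A = i
   B. *)
have orth u : hdot y1 (Rm *m u) + hdot y2 (Qm *m u) = 0.
  rewrite -hdot_col vsubmxK YE hdotMl /weyl_vec hdotMl mxstarK Wc_col hdot_col.
  rewrite hdotZl hdotMl mxstarK mulmxA PA rmorphN /= conjCi opprK -scalemxAl hdotZr.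
  by rewrite mulrA -expr2 sqrCi mulN1r addNr.
(* As R^* R <= Q^* Q, a kernel vector of Q is also one of R, against positive definiteness. *)
have Qu : Qm \in unitmx.
  apply: unitmx_ker0 => u Qu0; apply/eqP; apply: contraT => /pd'.
  have := psd' u; rewrite Qu0 hdot0r addr0 => le lt.
  by move: (lt_le_trans lt le); rewrite ltxx.
pose u := invmx Qm *m y2; have Qy : Qm *m u = y2 by rewrite mulKVmx.
have := orth u; rewrite Qy => /eqP; rewrite addr_eq0 => /eqP o1.
have o2 : hdot (Rm *m u) y1 = - hdot y2 y2.
  by rewrite -hdot_conj o1 rmorphN /= hdot_conj.
have -> : hdot Y (j *m Y) = hdot y1 y1 - hdot y2 y2.
  by rewrite -[Y]vsubmxK mul_j_col hdot_col hdotNr.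
(* Cauchy-Schwarz by completing a square: |y1 + R u|^2 = |y1|^2 - 2|y2|^2 + |R u|^2, and |R u|^2 <=
   |y2|^2. *)
have := hdot_ge0 (y1 + Rm *m u); rewrite hdotDl !hdotDr o1 o2.
have := psd' u; rewrite Qy -subr_ge0 => h1 h2.
have := addr_ge0 h1 h2; congr (0 <= _).
by move: (hdot _ _) (hdot _ _) (hdot _ _) => a b c; ring.
Qed.

End LinearFractional.

(** * Pointwise uniqueness *)

Lemma weyl_unique l (P Q : 'M[C]_p) : upperHP l ->
  (forall x, energy_bounded l (weyl_vec P x)) ->
  (forall x, energy_bounded l (weyl_vec Q x)) ->
  P = Q.
Proof.
move=> lu bP bQ; apply/eqP; rewrite -subr_eq0; apply: contraT => /eqP PQ.
have [x dx] : exists x : 'cV_p, (P - Q) *m x != 0.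
  apply: contrapT => nex; apply: PQ; apply/matrixP => a b.
  have : (P - Q) *m delta_mx b 0 = 0 :> 'cV_p.
    by apply/eqP; apply: contraT => h; case: nex; exists (delta_mx b 0).
  by move/matrixP/(_ a 0); rewrite -colE !mxE.
have [d dE] : exists d, d = (P - Q) *m x by eexists.
rewrite -dE in dx.
(* The coefficients of the last two vectors cancel their lower blocks and leave - s (P - Q) x = - s
   d in the upper one. *)
pose v (s : C) := weyl_vec Q d +
  (weyl_vec P ((- 'i * s) *: x) + weyl_vec Q (('i * s) *: x)).
have vE s : v s = mxstar K *m col_mx ((- 'i) *: (Q *m d) - s *: d) d.
  rewrite /v /weyl_vec -!mulmxDr !add_col_mx; congr (_ *m col_mx _ _); last first.
    by rewrite -scalerDl -mulrDl addNr mul0r scale0r addr0.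
  congr (_ + _); rewrite -!scalemxAr !scalerA dE mulmxBl scalerBr opprB addrC.
  rewrite -scaleNr; congr (_ *: _ + _ *: _).
    by rewrite mulrA mulNr -expr2 sqrCi opprK mul1r.
  by rewrite mulrA mulrNN -expr2 sqrCi mulN1r.
have v_ge0 s : 0 <= hdot (v s) (j *m v s).
  have bv : energy_bounded l (v s) :=
    energy_boundedD (bQ _) (energy_boundedD (bP _) (bQ _)).
  exact: energy_bounded_ge0 lu bv.
(* K^* turns the j-form into the J-form, which pairs the upper block with the lower one: the
   dependence on real s is affine, with slope -2|d|^2. *)
have form s : s^* = s ->
    hdot (v s) (j *m v s) = hdot (v 0) (j *m v 0) - s * (2 * hdot d d).
  move=> sr; rewrite !vE !hdot_Kstar_j !mul_J_col !hdot_col.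
  rewrite !(hdotDl, hdotDr, hdotNl, hdotNr) ![hdot (s *: d) d]hdotZl
    ![hdot d (s *: d)]hdotZr.
  rewrite !scale0r hdot0r -[hdot 0 _]hdot_conj hdot0r conjC0 sr.
  by move: (hdot _ _) (hdot _ _) (hdot _ _) => a b c; ring.
have [||n hn] := @complex_archi R (hdot (v 0) (j *m v 0)) (2 * hdot d d) => //.
  by rewrite mulr_gt0 ?ltr0n// hdot_gt0.
have := v_ge0 n%:R; rewrite form ?rmorph_nat// [_%:R * (2 * _)]mulr_natl subr_ge0 => le.
by move: (le_lt_trans le hn); rewrite ltxx.
Qed.

End Dynamics.

(** * Limits of complex numbers and matrices along a filter *)

Section Limits.
Variable R : realType.
Local Notation C := R[i].

(** Stands in for a minimum: the order of [R[i]] is partial, but positive elements are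
    comparable. *)
Lemma exists_le_both (a b : C) : 0 < a -> 0 < b ->
  exists2 d, 0 < d & d <= a /\ d <= b.
Proof.
move=> a0 b0; case: (real_leP (gtr0_real a0) (gtr0_real b0)) => ab.
  by exists a.
by exists b => //; split=> //; exact: ltW.
Qed.

(** Stated for any filter, so that one calculus serves sequences ([eventually]) and continuity at a
    point ([cnbhs]). *)
Definition climit T (F : set_system T) (f : T -> C) (a : C) :=
  forall e, 0 < e -> F (fun t => `|f t - a| < e).

Definition mxlimit T (F : set_system T) m n (f : T -> 'M[C]_(m, n))
    (A : 'M[C]_(m, n)) :=
  forall i j, climit F (fun t => f t i j) (A i j).

Section Filter.
Variables (T : Type) (F : set_system T).
Context {FF : Filter F}.

Lemma climit_cst a : climit F (fun=> a) a.
Proof. by move=> e e0; apply: filterE => t; rewrite subrr normr0. Qed.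

Lemma climitD f g a b : climit F f a -> climit F g b ->
  climit F (fun t => f t + g t) (a + b).
Proof.
move=> fa gb e e0; have e2 : 0 < e / 2 by rewrite divr_gt0.
apply: filterS (filterI (fa _ e2) (gb _ e2)) => t [h1 h2].
rewrite opprD addrACA (le_lt_trans (ler_normD _ _))//.
by rewrite [e](splitr e) ltrD.
Qed.

Lemma climitM f g a b : climit F f a -> climit F g b ->
  climit F (fun t => f t * g t) (a * b).
Proof.
move=> fa gb e e0.
(* The tolerances fit f g - a b = f (g - b) + (f - a) b, where |f| <= |a| + 1 as soon as |f - a| <
   1. *)
have A0 : 0 < `|a| + 1 by rewrite ltr_wpDl.
have B0 : 0 < `|b| + 1 by rewrite ltr_wpDl.
have eA : 0 < e / 2 / (`|a| + 1) by rewrite !divr_gt0.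
have eB : 0 < e / 2 / (`|b| + 1) by rewrite !divr_gt0.
apply: filterS (filterI (filterI (fa _ ltr01) (fa _ eB)) (gb _ eA)) => t [[h1 h2] h3].
have -> : f t * g t - a * b = f t * (g t - b) + (f t - a) * b by ring.
rewrite (le_lt_trans (ler_normD _ _))// !normrM [e](splitr e).
have fA : `|f t| <= `|a| + 1.
  by rewrite -[f t](subrK a) addrC (le_trans (ler_normD _ _))// lerD2l ltW.
apply: ltr_leD.
  apply: (@le_lt_trans _ _ ((`|a| + 1) * `|g t - b|)).
    by rewrite ler_wpM2r.
  by rewrite -ltr_pdivlMl// mulrC.
apply: (@le_trans _ _ (e / 2 / (`|b| + 1) * (`|b| + 1))).
  by apply: ler_pM => //; [exact: ltW | rewrite lerDl].
by rewrite divfK// gt_eqF.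
Qed.

Lemma climit_sum (I : Type) (r : seq I) (f : I -> T -> C) a :
  (forall i, climit F (f i) (a i)) ->
  climit F (fun t => \sum_(i <- r) f i t) (\sum_(i <- r) a i).
Proof.
move=> fa; elim: r => [|i r IH].
  rewrite big_nil; have -> : (fun t => \sum_(i <- [::]) f i t) = fun=> 0.
    by apply: funext => t; rewrite big_nil.
  exact: climit_cst.
rewrite big_cons; have -> : (fun t => \sum_(i <- i :: r) f i t) =
    fun t => f i t + \sum_(i <- r) f i t.
  by apply: funext => t; rewrite big_cons.
exact: climitD.
Qed.

Lemma climit_conj f a : climit F f a -> climit F (fun t => (f t)^*) a^*.
Proof.
by move=> fa e e0; apply: filterS (fa _ e0) => t; rewrite -rmorphB norm_conjC.
Qed.

Lemma climitV f a : a != 0 -> climit F f a -> climit F (fun t => (f t)^-1) a^-1.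
Proof.
move=> a0 fa e e0; have na : 0 < `|a| by rewrite normr_gt0.
have e1 : 0 < `|a| / 2 by rewrite divr_gt0.
(* Near a, |f| > |a|/2, so |1/f - 1/a| = |a - f| / |f a| is below e. *)
have e2 : 0 < e * (`|a| / 2 * `|a|) by rewrite mulr_gt0// mulr_gt0.
apply: filterS (filterI (fa _ e1) (fa _ e2)) => t [h1 h2].
have fl : `|a| / 2 < `|f t|.
  have := ler_normD (f t) (a - f t); rewrite addrC subrK distrC => h3.
  rewrite -(ltrD2r (`|a| / 2)) -splitr (le_lt_trans h3)// ltrD2l//.
have f0 : f t != 0 by rewrite -normr_gt0 (lt_trans e1).
have -> : (f t)^-1 - a^-1 = (a - f t) / (f t * a) by field; rewrite f0 a0.
rewrite normrM normfV normrM ltr_pdivrMr ?mulr_gt0 ?normr_gt0// distrC.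
by rewrite (lt_le_trans h2)// ler_pM2l// ler_pM2r// ltW.
Qed.

Lemma mxlimit_cst m n (A : 'M[C]_(m, n)) : mxlimit F (fun=> A) A.
Proof. by move=> i j; exact: climit_cst. Qed.

Lemma mxlimitD m n (f g : T -> 'M[C]_(m, n)) (A B : 'M_(m, n)) :
  mxlimit F f A -> mxlimit F g B ->
  mxlimit F (fun t => f t + g t) (A + B).
Proof.
move=> fA gB i j; rewrite mxE.
under [fun t => _]funext do rewrite mxE.
exact: climitD.
Qed.

Lemma mxlimitZ m n f (g : T -> 'M[C]_(m, n)) a (B : 'M_(m, n)) :
  climit F f a -> mxlimit F g B ->
  mxlimit F (fun t => f t *: g t) (a *: B).
Proof.
move=> fA gB i j; rewrite mxE.
under [fun t => _]funext do rewrite mxE.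
exact: climitM.
Qed.

Lemma mxlimitM m n q (f : T -> 'M[C]_(m, n)) (g : T -> 'M[C]_(n, q))
    (A : 'M_(m, n)) (B : 'M_(n, q)) :
  mxlimit F f A -> mxlimit F g B -> mxlimit F (fun t => f t *m g t) (A *m B).
Proof.
move=> fA gB i j; rewrite mxE.
under [fun t => _]funext do rewrite mxE.
by apply: climit_sum => k; exact: climitM.
Qed.

Lemma mxlimit_star m n (f : T -> 'M[C]_(m, n)) (A : 'M_(m, n)) : mxlimit F f A ->
  mxlimit F (fun t => mxstar (f t)) (mxstar A).
Proof.
move=> fA i j; rewrite !mxE.
under [fun t => _]funext do rewrite !mxE.
exact: climit_conj.
Qed.

Lemma mxlimit_col m1 m2 n (f : T -> 'M[C]_(m1, n)) (g : T -> 'M[C]_(m2, n))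
    (A : 'M_(m1, n)) (B : 'M_(m2, n)) :
  mxlimit F f A -> mxlimit F g B ->
  mxlimit F (fun t => col_mx (f t) (g t)) (col_mx A B).
Proof.
move=> fA gB i j; rewrite mxE.
under [fun t => _]funext do rewrite mxE.
by case: (split i) => k; [exact: fA | exact: gB].
Qed.

Lemma climit_hdot n (f g : T -> 'cV[C]_n) (a b : 'cV_n) :
  mxlimit F f a -> mxlimit F g b ->
  climit F (fun t => hdot (f t) (g t)) (hdot a b).
Proof. by move=> fa gb; apply: mxlimitM => //; exact: mxlimit_star. Qed.

End Filter.

Definition cnbhs (z : C) : set_system C :=
  fun A => exists2 d, 0 < d & forall w, `|w - z| < d -> A w.

#[global] Instance cnbhs_filter z : Filter (cnbhs z).
Proof.
split.
- by exists 1.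
- move=> P Q [d d0 hP] [d' d0' hQ]; have [e e0 [ed ed']] := exists_le_both d0 d0'.
  by exists e => // w we; split; [apply: hP | apply: hQ]; rewrite (lt_le_trans we).
- by move=> P Q PQ [d d0 hP]; exists d => // w /hP /PQ.
Qed.

Lemma climit_id z : climit (cnbhs z) id z.
Proof. by move=> e e0; exists e. Qed.

(** Near z the difference quotient is bounded by |l| + 1, which gives a Lipschitz estimate at z. *)
Lemma cdiff_climit f z : cdiff_at f z -> climit (cnbhs z) f (f z).
Proof.
move=> [l /(_ 1 ltr01)[d [d0 hd]]] e e0.
have l0 : 0 < `|l| + 1 by rewrite ltr_wpDl.
have [r r0 [rd re]] := exists_le_both d0 (divr_gt0 e0 l0).
exists r => // w wr; have [->|wz] := eqVneq w z; first by rewrite subrr normr0.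
have h0 : 0 < `|w - z| by rewrite normr_gt0 subr_eq0.
have := hd (w - z); rewrite h0 (lt_le_trans wr rd) => /(_ isT).
rewrite [z + _]addrC subrK => h.
have : `|(f w - f z) / (w - z)| < `|l| + 1.
  rewrite -[_ / _](subrK l) (le_lt_trans (ler_normD _ _))// addrC ltrD2l//.
rewrite normf_div ltr_pdivrMr// => /lt_trans; apply.
by rewrite -ltr_pdivlMl// mulrC (lt_le_trans wr).
Qed.

(** Reality of f z turns a failure of 0 <= f z into f z < 0; closeness within - f z then makes
    nearby values negative. *)
Lemma climit_ge0 z f : climit (cnbhs z) f (f z) ->
  f z \is Num.real -> (forall d, 0 < d -> exists w, `|w - z| < d /\ 0 <= f w) ->
  0 <= f z.
Proof.
move=> fz fr dense; rewrite real_leNgt ?real0//; apply/negP => neg.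
have [|d d0 hd] := fz (- f z); first by rewrite oppr_gt0.
have [w [/hd h w0]] := dense d d0.
move: h; rewrite ger0_norm ?subr_ge0 ?(le_trans (ltW neg))//.
by rewrite gtrDr => /(le_lt_trans w0); rewrite ltxx.
Qed.

(** All terms lie above u 0 = 0, hence are real, and the limit is the supremum of their real
    parts. *)
Lemma monotone_climit (u : nat -> C) (M : C) : (forall n, u n <= u n.+1) ->
  u 0%N = 0 -> (forall n, u n <= M) -> exists l, climit eventually u l.
Proof.
move=> inc u0 uM.
have mono m n : (m <= n)%N -> u m <= u n.
  by move/subnK <-; elim: (n - m)%N => //= k /le_trans; apply; rewrite addSn.
have ur n : u n = (complex.Re (u n))%:C%C.
  by rewrite RRe_real// ger0_real// -u0 mono.
pose r n := complex.Re (u n); pose E : set R := range r.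
have rM n : r n <= complex.Re M by have := uM n; rewrite lecE => /andP[].
have supE : has_sup E.
  split; first by exists (r 0%N); exists 0%N.
  by exists (complex.Re M) => _ [n _ <-].
exists (sup E)%:C%C => e e0.
have eE : (complex.Re e)%:C%C = e by rewrite RRe_real// gtr0_real.
have e0' : 0 < complex.Re e by rewrite -ltcR eE.
have [_ [m _ <-] hm] := sup_adherent e0' supE.
exists m => // n /= mn.
have le : u n <= (sup E)%:C%C.
  by rewrite ur lecR; apply: ub_le_sup; [exact: (proj2 supE) | exists n].
rewrite distrC ger0_norm ?subr_ge0// ltrBlDr -ltrBlDl.
by apply: (lt_le_trans _ (mono _ _ mn)); rewrite ur -eE -rmorphB ltcR.
Qed.

Lemma climit_bounded (u : nat -> C) l : (forall n, u n <= u n.+1) ->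
  u 0%N = 0 -> climit eventually u l -> exists M, forall n, u n <= M.
Proof.
move=> inc u0 /(_ 1 ltr01)[N _ hN].
have mono m n : (m <= n)%N -> u m <= u n.
  by move/subnK <-; elim: (n - m)%N => //= k /le_trans; apply; rewrite addSn.
exists (`|l| + 1) => n; apply: le_trans (mono _ _ (leq_maxl n N)) _.
rewrite -[u _]ger0_norm; last by rewrite -u0 mono.
rewrite -[u _](subrK l) addrC (le_trans (ler_normD _ _))// lerD2l ltW//.
by apply: hN; rewrite /= leq_maxr.
Qed.

(* By polarization from e_a, e_b, e_a + e_b and e_a + i e_b. *)
Lemma mx_form_climit n (S : nat -> 'M[C]_n) :
  (forall x : 'cV_n, exists l, climit eventually (fun k => hdot x (S k *m x)) l) ->
  exists L, mxlimit eventually S L.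
Proof.
move=> conv.
suff /choice[L hL] : forall ab : 'I_n * 'I_n,
    exists l, climit eventually (fun k => S k ab.1 ab.2) l.
  by exists (\matrix_(a, b) L (a, b)) => a b; rewrite mxE; exact: (hL (a, b)).
move=> [a b] /=; pose e i : 'cV[C]_n := delta_mx i 0.
have entry k i j : hdot (e i) (S k *m e j) = S k i j.
  rewrite /hdot.
  have -> : mxstar (e i) = delta_mx 0 i.
    by apply/matrixP => s t; rewrite !mxE rmorph_nat andbC.
  by rewrite -colE -rowE !mxE.
have [la hla] := conv (e a); have [lb hlb] := conv (e b).
have [l1 hl1] := conv (e a + e b); have [l2 hl2] := conv (e a + 'i *: e b).
(* With Q(x) = x^* S x, the first bracket is S_ab + S_ba and the second i (S_ab - S_ba). *)
exists (2^-1 * (l1 + - la + - lb) + - 'i / 2 * (l2 + - la + - lb)).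
have -> : (fun k => S k a b) = fun k => 2^-1 * (hdot (e a + e b) (S k *m (e a + e b))
     + (-1) * hdot (e a) (S k *m e a) + (-1) * hdot (e b) (S k *m e b))
   + - 'i / 2 * (hdot (e a + 'i *: e b) (S k *m (e a + 'i *: e b))
     + (-1) * hdot (e a) (S k *m e a) + (-1) * hdot (e b) (S k *m e b)).
  apply: funext => k.
  rewrite !mulmxDr -!scalemxAr !(hdotDl, hdotDr, hdotZl, hdotZr) !entry conjCi.
  move: (S k a a) (S k a b) (S k b a) (S k b b) => s t w z.
  move: 'i (sqrCi C) => i i2.
  have -> : 2^-1 * (s + t + (w + z) + -1 * s + -1 * z) +
      - i / 2 * (s + i * t + (- i * w + - i * (i * z)) + -1 * s + -1 * z) =
    (t + w - i ^+ 2 * (t - w) + i * (1 + i ^+ 2) * z) / 2 by ring.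
  by rewrite i2; field.
rewrite -(mulN1r la) -(mulN1r lb).
have comb f f0 g g0 h h0 : climit eventually f f0 -> climit eventually g g0 ->
    climit eventually h h0 ->
    climit eventually (fun k => f k + (-1) * g k + (-1) * h k)
      (f0 + (-1) * g0 + (-1) * h0).
  move=> hf hg hh; apply: climitD; last by apply: climitM hh; exact: climit_cst.
  by apply: climitD => //; apply: climitM hg; exact: climit_cst.
by apply: climitD; apply: climitM (comb _ _ _ _ _ _ _ hla hlb) => //;
  exact: climit_cst.
Qed.

End Limits.

(** * From the classes N(N) to convergence of the Weyl series *)

Section WeylFunction.
Variables (R : realType) (p : nat).
Local Notation C := (R[i]).
Local Notation j := (jmx R p).
Local Notation J := (Jmx R p).
Local Notation K := (Kmx R p).
Variable beta : nat -> 'M[C]_(p, p + p).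
Hypothesis betaJ : forall k, beta k *m J *m mxstar (beta k) = 1%:M.
Local Notation W := (Wmx beta).
Local Notation energy := (energy beta).
Local Notation energy_bounded := (energy_bounded beta).

Lemma cdiff_conj (f : C -> C) z : cdiff_at f z^* -> cdiff_at (fun w => (f w^*)^*) z.
Proof.
move=> [l hl]; exists l^* => e /hl[d [d0 hd]]; exists d; split=> // h hh.
rewrite -norm_conjC rmorphB rmorphM fmorphV rmorphB /= !conjCK rmorphD /=.
by apply: hd; rewrite norm_conjC.
Qed.

Lemma lowerHP_conj (z : C) : upperHP z -> lowerHP z^*.
Proof. by rewrite /upperHP /lowerHP Im_conj oppr_lt0. Qed.

Lemma upperHP_conj (z : C) : lowerHP z -> upperHP z^*.
Proof. by rewrite /upperHP /lowerHP Im_conj oppr_gt0. Qed.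

Lemma hdot_weyl_sum phi l n x :
  hdot x ((\sum_(k < n) weyl_term beta phi l k) *m x) =
  \sum_(k < n) energy l k (weyl_vec (phi l) x).
Proof.
elim: n => [|n IH]; first by rewrite !big_ord0 mul0mx hdot0r.
by rewrite !big_ord_recr /= mulmxDl hdotDr IH hdot_weyl_term.
Qed.

Lemma energy_sum_le l n u :
  \sum_(k < n) energy l k u <= \sum_(k < n.+1) energy l k u.
Proof. by rewrite big_ord_recr /= lerDl energy_ge0. Qed.

(** Forward, each quadratic form of the partial sums is monotone and convergent, hence bounded.
    Backward, bounded monotone forms converge, and [mx_form_climit] recovers the matrix limit. *)
Lemma weyl_series_cvgP phi l : weyl_series_cvg beta phi l <->
  forall x, energy_bounded l (weyl_vec (phi l) x).
Proof.
pose S n := \sum_(k < n) weyl_term beta phi l k.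
split=> [[L hL] x|bnd].
  have SL : mxlimit eventually S L.
    by move=> a b e /(hL a b)[M hM]; exists M => // n; exact: hM.
  apply: (@climit_bounded _ _ (hdot x (L *m x))) => [n||].
  - exact: energy_sum_le.
  - by rewrite big_ord0.
  under [fun n => _]funext do rewrite -hdot_weyl_sum.
  by apply: climit_hdot; [exact: mxlimit_cst | apply: mxlimitM; last exact: mxlimit_cst].
have [x|L hL] := @mx_form_climit _ _ S; last first.
  by exists L => a b e /(hL a b)[M _ hM]; exists M => n; exact: hM.
have [M hM] := bnd x.
apply: (@monotone_climit _ _ M) => [n||n]; rewrite ?hdot_weyl_sum//.
- exact: energy_sum_le.
- by rewrite big_ord0.
Qed.

Lemma mxlimit_W n (z : C) : z != 0 ->
  mxlimit (cnbhs z) (fun w => W n w^*) (W n z^*).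
Proof.
move=> z0; elim: n => [|n IH]; first exact: mxlimit_cst.
have WS w : W n.+1 w = W n w + (- 'i * w^-1) *: (j *m Cmx beta n *m W n w).
  by rewrite mulNr scaleNr.
under [fun w => _]funext do rewrite WS.
rewrite WS; apply: mxlimitD => //; apply: mxlimitZ; last first.
  by apply: mxlimitM => //; exact: mxlimit_cst.
apply: climitM; first exact: climit_cst.
by apply: climitV; [rewrite conjC_eq0 | apply: climit_conj; exact: climit_id].
Qed.

Lemma discrete_complement_dense (S : C -> Prop) z d : discrete_in (@lowerHP R) S ->
  lowerHP z -> 0 < d -> exists w, [/\ `|w - z| < d, lowerHP w & ~ S w].
Proof.
move=> dS lz d0; have [r [r0 hr]] := dS z lz.
have [t t0 [td tr]] := exists_le_both d0 r0.
have t2 : 0 < t / 2 by rewrite divr_gt0.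
have tt : t / 2 < t by rewrite ltr_pdivrMr// ltr_pMr// ltr1n.
have dist : `|z + t / 2 - z| = t / 2 by rewrite addrC addKr gtr0_norm.
(* A real shift preserves the imaginary part, and it is short enough to meet no point of S. *)
exists (z + t / 2); split.
- by rewrite dist (lt_le_trans tt).
- by rewrite /lowerHP raddfD /= (Creal_ImP _ (gtr0_real t2)) addr0.
- move=> /hr; rewrite dist (lt_le_trans tt tr) => /(_ isT)/eqP.
  by rewrite -subr_eq0 addrC addKr gt_eqF.
Qed.

(** Off S, [lft_flux_ge0] applies. The form h involves only phi and W, both continuous on the whole
    lower half-plane, so its sign extends across S. *)
Lemma Nset_flux_ge0 N phi l x : in_Nset beta N phi -> upperHP l ->
  0 <= jflux beta l N.+1 (weyl_vec (mxstar (phi l^*)) x).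
Proof.
move=> [holo [S [Rf [Qf [[_ [dS _]] [_ [_ [RQ /= [_ lft]]]]]]]]] lu.
pose Y z := W N.+1 z^* *m weyl_vec (mxstar (phi z)) x.
pose h z := hdot (Y z) (j *m Y z).
have h_ge0 z : lowerHP z -> ~ S z -> 0 <= h z.
  move=> lz nS; have [pd psd] := RQ z lz nS.
  have uz := upperHP_conj lz.
  have unitA := lft_denominator_unit betaJ N uz pd psd.
  exact: (lft_flux_ge0 betaJ uz pd psd (lft z lz nS unitA) (erefl (Y z))).
suff : 0 <= h l^*.
  rewrite /h /Y conjCK => hl; apply: mulr_ge0 => //.
  by rewrite exprn_ge0// ltW// qfun_gt0.
have lz := lowerHP_conj lu; move: (l^*) lz => z lz {l lu}.
have z0 : z != 0 by apply/eqP => z0; move: lz; rewrite z0 /lowerHP raddf0 ltxx.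
have phiz : mxlimit (cnbhs z) phi (phi z).
  by move=> a b; apply: cdiff_climit; exact: holo.
have Yz : mxlimit (cnbhs z) Y (Y z).
  apply: mxlimitM; first exact: mxlimit_W.
  apply: mxlimitM; first exact: mxlimit_cst.
  apply: mxlimit_col; last exact: mxlimit_cst.
  apply: mxlimitZ; first exact: climit_cst.
  by apply: mxlimitM; [exact: mxlimit_star | exact: mxlimit_cst].
apply: (@climit_ge0 _ z h).
- apply: climit_hdot; first exact: Yz.
  by apply: mxlimitM; [exact: mxlimit_cst | exact: Yz].
- by rewrite form_real// mxstar_j.
- move=> d /(discrete_complement_dense dS lz)[w [wd lw nS]].
  by exists w; split=> //; exact: h_ge0.
Qed.

Lemma flux_energy_bounded l u : upperHP l ->
  (forall n, 0 <= jflux beta l n.+1 u) -> energy_bounded l u.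
Proof.
move=> lu flux; have kap0 : 0 < qfun l * kapfun l by rewrite mulr_gt0 ?qfun_gt0 ?kap_gt0.
exists (hdot u (j *m u) / (qfun l * kapfun l)) => n.
(* The sign of the flux is known only from index 1 on, so the sum is first enlarged by one term. *)
apply: le_trans (energy_sum_le _ _ _) _.
by rewrite ler_pdivlMr// mulrC energy_sum// gerBl flux.
Qed.


End WeylFunction.

Theorem theorem6p8 (R : realType) (p : nat)
    (beta : nat -> 'M[R[i]]_(p, p + p)) (phi_inf : R[i] -> 'M[R[i]]_p) :
  (0 < p)%N ->
  (forall k, beta k *m Jmx R p *m mxstar (beta k) = 1%:M) ->
  (* phi_inf is the unique element of \bigcap_N \mathcal N(N) *)
  (forall N, in_Nset beta N phi_inf) ->
  (forall f, (forall N, in_Nset beta N f) ->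
     forall z, lowerHP z -> f z = phi_inf z) ->
  let psi := fun z : R[i] => mxstar (phi_inf (Num.conj z)) in
  mx_holo_on (@upperHP R) psi /\
  (forall z, upperHP z -> weyl_series_cvg beta psi z) /\
  (forall phi : R[i] -> 'M[R[i]]_p,
     mx_holo_on (@upperHP R) phi ->
     (forall z, upperHP z -> weyl_series_cvg beta phi z) ->
     forall z, upperHP z -> phi z = psi z).
Proof.
move=> _ betaJ inN _ psi.
(* Membership in N(n) supplies the sign of the flux at index n + 1, for every n. *)
have bnd z x : upperHP z -> energy_bounded beta z (weyl_vec (psi z) x).
  by move=> uz; apply: flux_energy_bounded => // n; exact: Nset_flux_ge0.
split; [|split].
- move=> a b z uz; rewrite /psi.
  under [fun w => _]funext do rewrite !mxE.
  apply: (@cdiff_conj R (fun w => phi_inf w b a)); apply: (inN 0%N).1.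
  exact: lowerHP_conj.
- by move=> z uz; apply/weyl_series_cvgP => // x; exact: bnd.
- move=> phi _ cvg z uz; apply: (weyl_unique betaJ uz) => x; last exact: bnd.
  by apply: (weyl_series_cvgP betaJ phi z).1; exact: cvg.
Qed.
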